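(* Let $N$ be a finite set. The integer kernel $\ker_{\mathbb{Z}}\mathcal{U}_N$, as a submodule of $\mathbb{Z}^{|\mathcal{E}(N)|}$, is generated by $\mathcal{B}$.
   Context: Unions of sets are written by juxtaposition and singletons $\{i\}$ as $i$. Functions on the power set $\mathcal{P}(N)$ are identified with vectors in $\mathbb{R}^{2^{|N|}}$; $\delta_A(S)=1$ if $S=A$ and $0$ otherwise. For distinct $a,b\in N$ and $C\subseteq N\setminus\{a,b\}$ the elementary imset is $u_{\langle a,b|C\rangle}=\delta_{abC}+\delta_C-\delta_{aC}-\delta_{bC}$ (so $u_{\langle a,b|C\rangle}=u_{\langle b,a|C\rangle}$), and $\mathcal{E}(N)$ is the set of all elementary imsets. $\mathcal{U}_N$ is the $2^{|N|}\times|\mathcal{E}(N)|$ integer matrix whose columns are the elementary imsets, and $\ker_{\mathbb{Z}}\mathcal{U}_N=\{z\in\mathbb{Z}^{|\mathcal{E}(N)|}\mid \mathcal{U}_Nz=0\}$, where coordinates of $z$ are indexed by $\mathcal{E}(N)$. Let $\delta_{\langle a,b|C\rangle}\in\mathbb{Z}^{|\mathcal{E}(N)|}$ be the unit vector with entry $1$ at $u_{\langle a,b|C\rangle}$ and $0$ elsewhere. $\mathcal{B}$ is the collection of all vectors $$\delta_{\langle a,b_1|C\rangle}+\delta_{\langle a,b_2|b_1C\rangle}-\delta_{\langle a,b_2|C\rangle}-\delta_{\langle a,b_1|b_2C\rangle}$$ over all distinct $a,b_1,b_2\in N$ and all $C\subseteq N\setminus\{a,b_1,b_2\}$. *)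

(* Defs.v *)
From mathcomp Require Import all_boot all_order all_algebra.

Set Implicit Arguments.
Unset Strict Implicit.
Unset Printing Implicit Defensive.

Import GRing.Theory.

Local Open Scope ring_scope.

Section ElementaryImsets.

Variable N : finType.

Definition delta (A : {set N}) : {ffun {set N} -> int} :=
  [ffun S => (S == A)%:R].

Definition elem_imset (a b : N) (C : {set N}) : {ffun {set N} -> int} :=
  delta ([set a; b] :|: C) + delta C - delta (a |: C) - delta (b |: C).

(* Triples (a, b, C) and (b, a, C) give the same imset: this list has
   repetitions, which disappear in the finite type [elem_type] of its members. *)
Definition elem_imsets : seq {ffun {set N} -> int} :=
  [seq let: (a, b, C) := t in elem_imset a b C |
    t in [pred t : N * N * {set N} |
      let: (a, b, C) := t in (a != b) && (C \subset ~: [set a; b])]].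

Definition elem_type : finType := seq_sub elem_imsets.

(* Rows are indexed by the subsets of N and columns by the elementary imsets,
   both through [enum_val]. *)
Definition imset_mx : 'M[int]_(#|{set N}|, #|elem_type|) :=
  \matrix_(i < #|{set N}|, j < #|elem_type|)
    val (enum_val j) (enum_val i).

(* The unit vector at the column [elem_imset a b C]; it is meant for a != b and
   C disjoint from [set a; b], so that this imset does occur as a column. *)
Definition delta_elem (a b : N) (C : {set N}) : 'cV[int]_#|elem_type| :=
  \col_(j < #|elem_type|) (val (enum_val j) == elem_imset a b C)%:R.

Definition exchange_vec (a b1 b2 : N) (C : {set N}) : 'cV[int]_#|elem_type| :=
  delta_elem a b1 C + delta_elem a b2 (b1 |: C)
  - delta_elem a b2 C - delta_elem a b1 (b2 |: C).

Definition exchange_vecs : seq 'cV[int]_#|elem_type| :=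
  [seq let: (a, b1, b2, C) := t in exchange_vec a b1 b2 C |
    t in [pred t : N * N * N * {set N} |
      let: (a, b1, b2, C) := t in
      [&& a != b1, a != b2, b1 != b2 & C \subset ~: [set a; b1; b2]]]].

End ElementaryImsets.

(* Main.v *)
(** Modulo the exchange vectors, a unit vector <a,b1|b2 C> may be replaced by
    <a,b2|b1 C> up to unit vectors with a smaller conditioning set. Both sit on
    the same set S = a b1 b2 C, and any two pairs inside S are joined by at most
    two such replacements; so, fixing one unit vector g_S for each S with at
    least two elements, every integer vector is congruent to an integer
    combination of the g_S. The imset of g_S is delta_S plus terms on proper
    subsets of S, so these imsets are linearly independent and a kernel vector
    is congruent to 0. *)
Require Import Defs.
From mathcomp Require Import all_boot all_order all_algebra.
From mathcomp Require Import ring.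

Set Implicit Arguments.
Unset Strict Implicit.
Unset Printing Implicit Defensive.

Import GRing.Theory.

Local Open Scope ring_scope.

(** * Closure properties of integer spans *)

Section IntegerSpan.

Variables (V : zmodType) (m : nat) (s : m.-tuple V).

Lemma inIntSpan0 : inIntSpan s 0.
Proof. by exists [ffun=> 0]; rewrite big1 // => i _; rewrite ffunE mulr0z. Qed.

Lemma inIntSpanB u v : inIntSpan s u -> inIntSpan s v -> inIntSpan s (u - v).
Proof.
move=> [a ->] [b ->]; exists [ffun i => a i - b i].
by rewrite -sumrB; apply: eq_bigr => i _; rewrite ffunE mulrzBr.
Qed.

Lemma inIntSpanMz u k : inIntSpan s u -> inIntSpan s (u *~ k).
Proof.
move=> [a ->]; exists [ffun i => a i * k].
by rewrite mulrz_suml; apply: eq_bigr => i _; rewrite ffunE mulrzA.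
Qed.

Lemma mem_inIntSpan u : u \in s -> inIntSpan s u.
Proof.
case/tnthP=> i ->; exists [ffun j => (j == i)%:Z].
rewrite (bigD1 i) //= ffunE eqxx (tnth_nth 0) big1 ?addr0 // => j ne_ji.
by rewrite ffunE (negPf ne_ji).
Qed.

End IntegerSpan.

Section ElementaryImsetKernel.

Variable N : finType.
Implicit Types (a b : N) (C S T : {set N}).

Notation vec := 'cV[int]_#|elem_type N|.
Notation inB := (inIntSpan (in_tuple (exchange_vecs N))).

(** * Elementary imsets as columns, and exchange vectors in the kernel *)

Lemma elem_imsetC a b C : elem_imset a b C = elem_imset b a C.
Proof. by rewrite /elem_imset (setUC [set a]) addrAC. Qed.

Lemma delta_elemC a b C : delta_elem a b C = delta_elem b a C.
Proof. by apply/matrixP=> i j; rewrite !mxE elem_imsetC. Qed.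

Lemma elem_imset_notin a b C S :
  ~~ (S \subset [set a; b] :|: C) -> elem_imset a b C S = 0.
Proof.
move=> nsS; have ne T : T \subset [set a; b] :|: C -> (S == T) = false.
  by move=> sT; apply: contraNF nsS => /eqP->.
rewrite !ffunE !ne ?subsetUr ?subxx //.
  by rewrite setSU // sub1set !inE eqxx orbT.
by rewrite setSU // sub1set !inE eqxx.
Qed.

(** The three other sets in the formula each miss [a] or [b], so only the first delta
    contributes. *)
Lemma elem_imset_top a b C : a != b -> C \subset ~: [set a; b] ->
  elem_imset a b C ([set a; b] :|: C) = 1.
Proof.
move=> ne_ab /subsetP sC.
have aC : a \notin C by apply/negP=> /sC; rewrite !inE eqxx.
have bC : b \notin C by apply/negP=> /sC; rewrite !inE eqxx orbT.
have neS T : (a \notin T) || (b \notin T) -> ([set a; b] :|: C == T) = false.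
  by case/orP; apply: contraNF => /eqP<-; rewrite !inE eqxx ?orbT.
rewrite !ffunE eqxx !neS ?aC //= ?addr0 ?subr0 // !inE.
- by rewrite (negPf ne_ab) (negPf aC).
- by rewrite [b == a]eq_sym (negPf ne_ab) (negPf bC) orbT.
Qed.

Lemma elem_imset_mem a b C : a != b -> C \subset ~: [set a; b] ->
  elem_imset a b C \in elem_imsets N.
Proof.
move=> ne_ab sC; apply/imageP; exists (a, b, C) => //.
by rewrite inE ne_ab.
Qed.

Lemma imset_mx_delta_elem a b C : a != b -> C \subset ~: [set a; b] ->
  imset_mx N *m delta_elem a b C = \col_i elem_imset a b C (enum_val i).
Proof.
move=> ne_ab sC; pose u : elem_type N := SeqSub (elem_imset_mem ne_ab sC).
apply/colP=> i; rewrite [LHS]mxE (bigD1 (enum_rank u)) //= !mxE enum_rankK eqxx.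
rewrite mulr1 big1 ?addr0 // => j ne_ju; rewrite !mxE.
suff /negPf-> : val (enum_val j) != elem_imset a b C by rewrite mulr0.
(* [elem_type] has no repetitions, so exactly one index carries this imset. *)
apply: contraNneq ne_ju => eq_j.
by apply/eqP/enum_val_inj; rewrite enum_rankK; apply: val_inj.
Qed.

(** The first two imsets sum to $\delta_{ab_1b_2C}+\delta_C-\delta_{aC}-\delta_{b_1b_2C}$, which is
    symmetric in $b_1$ and $b_2$; the last two give the same sum. *)
Lemma imset_mx_exchange_vec a b1 b2 C :
    a != b1 -> a != b2 -> b1 != b2 -> C \subset ~: [set a; b1; b2] ->
  imset_mx N *m exchange_vec a b1 b2 C = 0.
Proof.
move=> ne1 ne2 ne12 sC.
have sub b b' : b \in [set b1; b2] -> b' \in [set b1; b2] -> b != b' ->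
    b' |: C \subset ~: [set a; b] /\ C \subset ~: [set a; b].
  move=> bb bb' ne; suff sC' : b' |: C \subset ~: [set a; b].
    by split=> //; apply: subset_trans sC'; apply: subsetUr.
  apply/subsetP=> x; rewrite !inE => /predU1P[->|].
    rewrite eq_sym [b' == b]eq_sym (negPf ne) orbF.
    by case/set2P: bb' => ->.
  move/(subsetP sC); rewrite !inE -orbA !negb_or => /and3P[-> x1 x2] /=.
  by case/set2P: bb => ->.
have [s21 s1] := sub b1 b2 (set21 _ _) (set22 _ _) ne12.
have [s12 s2] : b1 |: C \subset ~: [set a; b2] /\ C \subset ~: [set a; b2].
  by apply: sub; rewrite ?set21 ?set22 // eq_sym.
have E : [set a; b1] :|: (b2 |: C) = [set a; b2] :|: (b1 |: C).
  by rewrite !setUA (setUAC [set a]).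
have E1 : [set a; b1] :|: C = a |: (b1 |: C) by rewrite setUA.
have E2 : [set a; b2] :|: C = a |: (b2 |: C) by rewrite setUA.
have E3 : b1 |: (b2 |: C) = b2 |: (b1 |: C) by rewrite setUCA.
rewrite /exchange_vec !(mulmxDr, mulmxN) !imset_mx_delta_elem //.
apply/colP=> i; rewrite !mxE /elem_imset E E1 E2 E3 !ffunE.
ring.
Qed.

Lemma inB_exchange a b1 b2 C :
    a != b1 -> a != b2 -> b1 != b2 -> C \subset ~: [set a; b1; b2] ->
  inB (exchange_vec a b1 b2 C).
Proof.
move=> ne1 ne2 ne12 sC; apply: mem_inIntSpan; apply/imageP.
by exists (a, b1, b2, C) => //; rewrite inE ne1 ne2 ne12.
Qed.

(** * Pivots: one unit vector chosen for each set, and their independence *)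

Definition pivot S : vec :=
  if [pick p : N * N | [&& p.1 != p.2, p.1 \in S & p.2 \in S]] is Some (a, b)
  (* With fewer than two elements in [S] there is no pair; the value 0 lets sums run over all
     sets. *)
  then delta_elem a b (S :\: [set a; b]) else 0.

Lemma setD_sub_pair a b S : S :\: [set a; b] \subset ~: [set a; b].
Proof. by rewrite setDE subsetIr. Qed.

Lemma setU_pairK a b S : a \in S -> b \in S ->
  [set a; b] :|: (S :\: [set a; b]) = S.
Proof.
move=> aS bS; rewrite setDE setUIr setUCr setIT.
by apply/setUidPr; rewrite subUset !sub1set aS.
Qed.

Lemma pivotP S : pivot S = 0 \/ exists a b,
  [/\ a != b, a \in S, b \in S & pivot S = delta_elem a b (S :\: [set a; b])].
Proof.
rewrite /pivot; case: pickP => [[a b] /and3P[/= ne aS bS]|_]; last by left.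
by right; exists a, b.
Qed.

Lemma pivot_pair S a b : a != b -> a \in S -> b \in S -> exists c d,
  [/\ c != d, c \in S, d \in S & pivot S = delta_elem c d (S :\: [set c; d])].
Proof.
move=> ne aS bS; rewrite /pivot.
case: pickP => [[c d] /and3P[/= ne' cS dS]|/(_ (a, b))]; first by exists c, d.
by rewrite /= ne aS bS.
Qed.

(** Triangularity: at a nonzero term with [S] of maximal cardinality, the coordinate at [S] of the
    image is [c S]. The conclusion concerns terms rather than coefficients because [c S] is
    arbitrary where the pivot is 0. *)
Lemma pivot_independent (c : {set N} -> int) :
  imset_mx N *m (\sum_S pivot S *~ c S) = 0 -> forall S, pivot S *~ c S = 0.
Proof.
move=> Uc0 S0; apply/eqP; apply: contraT => nz0.
have [S nzS maxS] := @arg_maxnP _ S0 (fun S => pivot S *~ c S != 0)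
  (fun S : {set N} => #|S|) nz0.
have [p0|[a [b [ne_ab aS bS pS]]]] := pivotP S.
  by rewrite p0 mul0rz eqxx in nzS.
have UT T : T != S -> (imset_mx N *m (pivot T *~ c T)) (enum_rank S) 0 = 0.
  move=> neTS; have [->|nzT] := eqVneq (pivot T *~ c T) 0.
    by rewrite mulmx0 mxE.
  have [p0|[a' [b' [ne' aT bT ->]]]] := pivotP T.
    by rewrite p0 mul0rz eqxx in nzT.
  rewrite raddfMz /= imset_mx_delta_elem ?setD_sub_pair //.
  rewrite -scaler_int !mxE enum_rankK elem_imset_notin ?mulr0 //.
  (* The imset of [pivot T] lives on subsets of [T]; if [S] were one of them, maximality of [#|S|]
     would force [T = S]. *)
  rewrite setU_pairK //; apply: contra neTS => sST.
  by rewrite eq_sym eqEcard sST; apply: maxS.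
move/colP/(_ (enum_rank S)): Uc0; rewrite [RHS]mxE mulmx_sumr summxE.
rewrite (bigD1 S) //= big1 // addr0 pS raddfMz /= imset_mx_delta_elem //;
  last exact: setD_sub_pair.
rewrite -scaler_int !mxE enum_rankK.
have := elem_imset_top ne_ab (setD_sub_pair a b S).
rewrite setU_pairK // => ->; rewrite mulr1 intz => c0.
by rewrite c0 mulr0z eqxx in nzS.
Qed.

(** * Reduction to combinations of pivots modulo the exchange vectors *)

Definition reducible (z : vec) :=
  exists c : {set N} -> int, inB (z - \sum_S pivot S *~ c S).

Lemma reducible_inB z : inB z -> reducible z.
Proof. by move=> Bz; exists (fun=> 0); rewrite big1 ?subr0. Qed.

Lemma reducible_pivot S : reducible (pivot S).
Proof.
exists (fun T => (T == S)%:Z).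
rewrite (bigD1 S) //= eqxx big1 ?addr0 ?subrr; first exact: inIntSpan0.
by move=> T /negPf->.
Qed.

Lemma reducibleB y z : reducible y -> reducible z -> reducible (y - z).
Proof.
move=> [c By] [d Bz]; exists (fun S => c S - d S).
under eq_bigr do rewrite mulrzBr.
rewrite sumrB (_ : y - z - _ = y - \sum_S pivot S *~ c S
  - (z - \sum_S pivot S *~ d S)); first exact: inIntSpanB.
by rewrite !opprB addrACA [RHS]addrACA [- z + _]addrC.
Qed.

Lemma reducibleD y z : reducible y -> reducible z -> reducible (y + z).
Proof.
move=> ry rz; rewrite -[z]opprK -[- z]sub0r; apply: reducibleB => //.
by apply: reducibleB => //; apply/reducible_inB/inIntSpan0.
Qed.

Lemma reducibleMz z k : reducible z -> reducible (z *~ k).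
Proof.
move=> [c Bz]; exists (fun S => c S * k).
under eq_bigr do rewrite mulrzA.
by rewrite -mulrz_suml -mulrzBl; apply: inIntSpanMz.
Qed.

(** One exchange replaces [b] by [c] in the pair while keeping [a]. The bound on [#|D|.+2], the size
    of [D] with [x] and [y] added, is the induction hypothesis for sets smaller than [S]. *)
Lemma reducible_swap S a b c :
    (forall x y (D : {set N}), x != y -> D \subset ~: [set x; y] ->
       (#|D|.+2 < #|S|)%N -> reducible (delta_elem x y D)) ->
    a \in S -> b \in S -> c \in S -> a != b -> a != c ->
  reducible (delta_elem a b (S :\: [set a; b])) ->
  reducible (delta_elem a c (S :\: [set a; c])).
Proof.
move=> IH aS bS cS ne_ab ne_ac Rab.
have [<- //|ne_bc] := eqVneq b c.
pose C := S :\: [set a; c; b].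
have sC : C \subset ~: [set a; c; b] by rewrite /C setDE subsetIr.
have lt_C : (#|C|.+2 < #|S|)%N.
  have cI : #|S :&: [set a; c; b]| = 3.
    rewrite (setIidPr _) ?subUset ?sub1set ?aS ?bS ?cS // setUC cardsU1 cards2.
    by rewrite ne_ac !inE negb_or eq_sym ne_ab ne_bc.
  by rewrite -(cardsID [set a; c; b] S) cI.
(* Returning one of [b], [c] to [C] gives the conditioning set of [a] with the other one. *)
have EC x y : x \in S -> x != a -> x != y ->
    [set a; c; b] = [set a; y] :|: [set x] -> x |: C = S :\: [set a; y].
  move=> xS xa xy; rewrite /C => ->; apply/setP=> w; rewrite !inE.
  have [->|//] := eqVneq w x; last by rewrite orbF.
  by rewrite (negPf xa) (negPf xy) xS.
have Eb : b |: C = S :\: [set a; c] by apply: EC; rewrite // eq_sym.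
have Ec : c |: C = S :\: [set a; b].
  by apply: EC => //; rewrite 1?eq_sym // setUAC.
have IHC x : x \in [set b; c] -> reducible (delta_elem a x C).
  move=> x_bc; apply: IH => //; first by case/set2P: x_bc => ->.
  apply: subset_trans sC _; rewrite setCS.
  case/set2P: x_bc => ->; apply/subsetP=> w; rewrite !inE;
    by case/orP=> ->; rewrite ?orbT.
(* The exchange relation solved for the wanted vector; the two terms conditioned on [C] fall under
   [IH]. *)
have -> : delta_elem a c (S :\: [set a; c]) =
    delta_elem a c C + delta_elem a b (S :\: [set a; b]) - delta_elem a b C
    - exchange_vec a c b C.
  by rewrite /exchange_vec Ec Eb opprB addrCA subrr addr0.
apply: reducibleB; last by apply/reducible_inB/inB_exchange; rewrite // eq_sym.
apply: reducibleB; last by apply: IHC; rewrite set21.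
by apply: reducibleD => //; apply: IHC; rewrite set22.
Qed.

(** Strong induction on [#|C|], starting from the pivot of the set [S] on which the vector sits. *)
Lemma reducible_delta_elem a b C : a != b -> C \subset ~: [set a; b] ->
  reducible (delta_elem a b C).
Proof.
have [n] := ubnP #|C|; elim: n a b C => // n IHn a b C /ltnSE le_Cn ne_ab sC.
set S := [set a; b] :|: C.
have aS : a \in S by rewrite !inE eqxx.
have bS : b \in S by rewrite !inE eqxx orbT.
have SC : S :\: [set a; b] = C.
  by rewrite setDUl setDv set0U; apply/setDidPl; rewrite disjoints_subset.
have cardS : #|S| = #|C|.+2.
  by rewrite -(cardsID [set a; b] S) SC (setIidPr _) ?subsetUl // cards2 ne_ab.
have IH x y (D : {set N}) : x != y -> D \subset ~: [set x; y] ->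
    (#|D|.+2 < #|S|)%N -> reducible (delta_elem x y D).
  rewrite cardS !ltnS => ne sD lt_D; apply: IHn => //.
  exact: leq_trans le_Cn.
have [d [c [ne_dc dS cS pS]]] := pivot_pair ne_ab aS bS.
have Rdc := reducible_pivot S; rewrite {}pS in Rdc.
(* From the pivot pair [d], [c]: one swap suffices if [d] is [a]; otherwise pass through the pair
   [d], [a], which meets both pairs. *)
rewrite -SC; have [ad|ne_ad] := eqVneq a d.
  by rewrite ad in ne_ab *; apply: (reducible_swap IH) Rdc.
apply: (reducible_swap IH) (ne_ad) _ _ => //.
rewrite delta_elemC [[set a; d]]setUC.
by apply: (reducible_swap IH) Rdc => //; rewrite eq_sym.
Qed.

Lemma reducibleT z : reducible z.
Proof.
rewrite [z]matrix_sum_delta; apply: (big_ind reducible) => [||i _].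
- exact/reducible_inB/inIntSpan0.
- exact: reducibleD.
rewrite big_ord1 -[z i 0]intz scaler_int; apply: reducibleMz.
have /imageP[[[a b] C] /andP[ne_ab sC] Ei] := valP (enum_val i).
suff -> : delta_mx i 0 = delta_elem a b C :> vec by apply: reducible_delta_elem.
apply/colP=> j; rewrite !mxE andbT -[elem_imset a b C]Ei.
(* Equal imsets have equal indices, so the standard basis vector at [i] is a [delta_elem]. *)
by rewrite (inj_eq val_inj) (inj_eq enum_val_inj).
Qed.

(** * The kernel and the span coincide *)

Lemma inB_kernel z : inB z -> imset_mx N *m z = 0.
Proof.
move=> [c ->]; rewrite mulmx_sumr big1 // => i _; rewrite raddfMz /=.
have /imageP[[[[a b1] b2] C] /and4P[ne1 ne2 ne12 sC] ->] :=
  mem_nth 0 (ltn_ord i : i < size (exchange_vecs N))%N.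
by rewrite imset_mx_exchange_vec ?mul0rz.
Qed.

End ElementaryImsetKernel.

Theorem theorem6p1 (N : finType) (z : 'cV[int]_#|elem_type N|) :
  imset_mx N *m z = 0 <-> inIntSpan (in_tuple (exchange_vecs N)) z.
Proof.
split=> [Uz0|]; last exact: inB_kernel.
have [c Bz] := reducibleT z.
(* Both [z] and its difference with the pivot sum are in the kernel, hence so is that sum, and
   independence kills each term. *)
suff p0 : \sum_S pivot S *~ c S = 0 by rewrite p0 subr0 in Bz.
apply: big1 => S _; apply: pivot_independent.
have := inB_kernel Bz; rewrite mulmxBr Uz0 => /eqP.
by rewrite sub0r oppr_eq0 => /eqP.
Qed.
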